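(* Let $X$ be a Banach space in which every relatively weakly compact subset is relatively super weakly compact. Then $X$ is weakly sequentially complete.
   Context: For a free ultrafilter $\mathcal{U}$ on $\mathbb{N}$, the ultrapower $X^{\mathcal{U}}$ of a Banach space $X$ is the quotient of $\ell_\infty(X)$ (the bounded sequences in $X$ with the supremum norm) by the subspace $N_{\mathcal{U}} = \{(x_n)_{n\in\mathbb{N}} \in \ell_\infty(X) : \lim_{\mathcal{U}} x_n = 0\}$. For $A \subseteq X$, $A^{\mathcal{U}}$ denotes the subset of $X^{\mathcal{U}}$ consisting of those elements which have a representative $(x_n)_{n\in\mathbb{N}}$ with $x_n \in A$ for each $n \in \mathbb{N}$. A subset $A$ of a Banach space $X$ is relatively super weakly compact if $A^{\mathcal{U}}$ is relatively weakly compact in $X^{\mathcal{U}}$ for every free ultrafilter $\mathcal{U}$ on $\mathbb{N}$. A sequence $(x_n)_{n\in\mathbb{N}}$ in $X$ is weakly Cauchy if for every $x^* \in X^*$ the scalar sequence $(x^*(x_n))_{n\in\mathbb{N}}$ is convergent. $X$ is weakly sequentially complete if every weakly Cauchy sequence in $X$ is weakly convergent (to an element of $X$). *)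

(* Defs.v *)
From HB Require Import structures.
From mathcomp Require Import all_boot all_order all_algebra.
From mathcomp Require Import generic_quotient ring_quotient.
From mathcomp Require Import complex.
From mathcomp Require Import all_classical all_reals all_analysis.
Set Implicit Arguments.
Unset Strict Implicit.
Unset Printing Implicit Defensive.
Import Order.TTheory GRing.Theory Num.Theory.
Import numFieldNormedType.Exports.
Local Open Scope classical_set_scope.
Local Open Scope ring_scope.
Local Open Scope quotient_scope.

(* Banach spaces are over either the reals or the complex numbers. Over [R[i]]
   norms are elements of [R[i]] that are real and nonnegative, and
   [x <= y] means that [y - x] is real and nonnegative. *)
Variant base_field := RealScalars | ComplexScalars.

Definition scalars (R : realType) (b : base_field) : numFieldType :=
  match b with
  | RealScalars => R : numFieldType
  | ComplexScalars => R[i] : numFieldType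
  end.

Section WeakTopology.
Variables (K : numFieldType) (V : normedModType K).

Record topdual := TopDual {
  dual_fun :> {linear V -> K^o} ;
  _ : continuous (dual_fun : V -> K^o)
}.

HB.instance Definition _ := gen_eqMixin topdual.
HB.instance Definition _ := gen_choiceMixin topdual.

(* The coarsest topology on V making all of its dual continuous. *)
Definition weak : Type :=
  initial_topology (fun v : V => (fun f => f v) : {ptws topdual -> K^o}).

HB.instance Definition _ := Topological.on weak.

Definition rel_weakly_compact (A : set V) : Prop := precompact (A : set weak).

Definition weakly_cauchy (x : nat -> V) : Prop :=
  forall f : topdual, cvg (f (x n) @[n --> \oo]).

Definition weakly_cvg_to (x : nat -> V) (l : V) : Prop :=
  (x : nat -> weak) @ \oo --> (l : weak).

Definition weakly_seq_complete : Prop :=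
  forall x : nat -> V, weakly_cauchy x -> exists l : V, weakly_cvg_to x l.

End WeakTopology.

Section BoundedSequences.
Variables (K : numFieldType) (X : normedModType K).

Definition bounded_seq : {pred (nat -> X)} :=
  fun x => `[< [bounded x n | n in [set: nat]] >].

Lemma bounded_seqP (x : nat -> X) :
  reflect (exists M : K, forall n, `|x n| <= M) (x \in bounded_seq).
Proof.
have F : ProperFilter (globally [set: nat]).
  exact: (globally_properfilter (a := 0%N)).
apply: (iffP (asboolP _)) => [/ex_bound[M xM]|[M xM]].
  by exists M => n; exact: xM.
by apply/ex_bound; exists M => n _; exact: xM.
Qed.

Lemma bounded_seq_submod_closed : submod_closed bounded_seq.
Proof.
split=> [|a x y /bounded_seqP[M xM] /bounded_seqP[N yN]]; apply/bounded_seqP.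
  by exists 0 => n /=; rewrite normr0.
exists (`|a| * M + N) => n /=.
by rewrite (le_trans (ler_normD _ _))// lerD// normrZ ler_wpM2l.
Qed.

HB.instance Definition _ :=
  GRing.isSubmodClosed.Build K (nat -> X) bounded_seq bounded_seq_submod_closed.

Record linf := Linf { linf_val :> nat -> X ; _ : linf_val \in bounded_seq }.

HB.instance Definition _ := [isSub for linf_val].
HB.instance Definition _ := [Choice of linf by <:].
HB.instance Definition _ := [SubChoice_isSubLmodule of linf by <:].

End BoundedSequences.

Section SupNorm.
Variables (R : realType) (b : base_field).
Local Notation K := (scalars R b).

Lemma scalars_supremums (A : set K) : A !=set0 -> (forall x, A x -> 0 <= x) ->
  ubound A !=set0 -> supremums A !=set0.
Proof.
case: b A => /= A [a Aa] A0 [u uA].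
  exists (sup A); split; first by apply: sup_ubound; exists u.
  by move=> y yA; apply: ge_sup => //; exists a.
have ImE z : 0 <= z :> R[i] -> z = (complex.Re z)%:C%C.
  by case: z => x y; rewrite lecE /= => /andP[/eqP-> _].
have upos : 0 <= u by rewrite (le_trans (A0 _ Aa))// uA.
pose B := [set complex.Re z | z in A].
have Bu : ubound B (complex.Re u).
  by move=> _ [z Az <-]; have := uA _ Az; rewrite lecE => /andP[].
exists (sup B)%:C%C; split => [z Az|y yA].
  rewrite (ImE _ (A0 _ Az)) lecR; apply: sup_ubound; first by exists (complex.Re u).
  by exists z.
rewrite (ImE y) ?lecR; last by rewrite (le_trans (A0 _ Aa))// yA.
apply: ge_sup; first by exists (complex.Re a), a.
by move=> _ [z Az <-]; have := yA _ Az; rewrite lecE => /andP[].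
Qed.

Lemma scalars_infimums (A : set K) : A !=set0 -> (forall x, A x -> 0 <= x) ->
  infimums A !=set0.
Proof.
move=> [a Aa] A0; have [] := @scalars_supremums [set l | 0 <= l /\ lbound A l].
- by exists 0.
- by move=> x [].
- by exists a => l [_]; exact.
move=> s [sub sleast]; exists s; split => [x Ax|l lA].
  by apply: sleast => l [_]; exact.
have : l \is Num.real.
  by rewrite (ler_real (lA _ Aa)) ger0_real// A0.
case/orP => l0; first exact: sub.
by rewrite (le_trans l0)// sub.
Qed.

Variable X : normedModType K.

Definition linf_norm (x : linf X) : K := supremum 0 (range (fun n => `|x n|)).

Lemma linf_norm_sup (x : linf X) :
  supremums (range (fun n => `|x n|)) (linf_norm x).
Proof.
have nx : range (fun n => `|x n|) !=set0 by exists `|x 0%N|, 0%N.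
rewrite /linf_norm /supremum ifF; last exact/negP/negP/set0P.
have [_ [n _ <-]//||s sx] := @scalars_supremums (range (fun n => `|x n|)) nx.
  have [M xM] := bounded_seqP _ (valP x).
  by exists M => _ [n _ <-]; exact: xM.
exact: (xgetI _ sx).
Qed.

Lemma linf_norm_ub (x : linf X) n : `|x n| <= linf_norm x.
Proof. by have [+ _] := linf_norm_sup x; apply; exists n. Qed.

Lemma linf_norm_le (x : linf X) M : (forall n, `|x n| <= M) -> linf_norm x <= M.
Proof. by move=> xM; have [_] := linf_norm_sup x; apply => _ [n _ <-]. Qed.

Lemma linf_normD (x y : linf X) : linf_norm (x + y) <= linf_norm x + linf_norm y.
Proof.
apply: linf_norm_le => n.
by rewrite (le_trans (ler_normD _ _))// lerD// linf_norm_ub.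
Qed.

Lemma linf_norm_ge0 (x : linf X) : 0 <= linf_norm x.
Proof. by rewrite (le_trans _ (linf_norm_ub x 0)). Qed.

Lemma linf_normZ (a : K) (x : linf X) :
  linf_norm (a *: x) = `|a| * linf_norm x.
Proof.
apply/eqP; rewrite eq_le; apply/andP; split.
  by apply: linf_norm_le => n; rewrite normrZ ler_wpM2l// linf_norm_ub.
have [->|a0] := eqVneq a 0; first by rewrite normr0 mul0r linf_norm_ge0.
rewrite -ler_pdivlMl ?normr_gt0//; apply: linf_norm_le => n.
by rewrite ler_pdivlMl ?normr_gt0// -normrZ (linf_norm_ub (a *: x)).
Qed.

Lemma linf_norm0_eq0 (x : linf X) : linf_norm x = 0 -> x = 0.
Proof.
move=> x0; apply/val_inj/funext => n; apply/eqP; rewrite -normr_le0 -x0.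
exact: linf_norm_ub.
Qed.

HB.instance Definition _ :=
  @Lmodule_isNormed.Build K (linf X) linf_norm linf_normD linf_normZ linf_norm0_eq0.

End SupNorm.

Record free_ultrafilter := FreeUltrafilter {
  fu_sets :> set_system nat ;
  fu_ultra : UltraFilter fu_sets ;
  fu_free : \bigcap_(A in fu_sets) A = set0
}.
#[global] Existing Instance fu_ultra.

Section NullSequences.
Variables (K : numFieldType) (X : normedModType K) (U : free_ultrafilter).

Definition null_seq : {pred linf X} := fun x => `[< x n @[n --> fu_sets U] --> (0 : X) >].

Lemma null_seq_submod_closed : submod_closed null_seq.
Proof.
split=> [|a x y /asboolP x0 /asboolP y0]; apply/asboolP; first exact: cvg_cst.
suff : (a *: x + y) n @[n --> fu_sets U] --> a *: (0 : X) + 0.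
  by rewrite scaler0 addr0.
by apply: cvgD => //; exact: cvgZl_tmp.
Qed.

HB.instance Definition _ :=
  GRing.isSubmodClosed.Build K (linf X) null_seq null_seq_submod_closed.

Definition ultrapower : Type := Quotient.quot null_seq.

HB.instance Definition _ := GRing.Zmodule.on ultrapower.

Definition ultra_class (x : linf X) : ultrapower := \pi_(Quotient.quot null_seq) x.

Lemma ultra_classD x y : ultra_class (x + y) = ultra_class x + ultra_class y.
Proof. exact: (@pi_addr _ _ _ _ _ (Quotient.quot null_seq)). Qed.

Lemma ultra_class0 : ultra_class 0 = 0.
Proof. by apply/(addrI (ultra_class 0)); rewrite -ultra_classD !addr0. Qed.

Lemma ultra_class_eq x y : ultra_class x = ultra_class y <-> x - y \in null_seq.
Proof. by rewrite Quotient.idealrBE; split => /eqP. Qed.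

Lemma ultra_class_surj (z : ultrapower) : exists x, ultra_class x = z.
Proof. by exists (repr (z : Quotient.quot null_seq)); exact: reprK. Qed.

Definition ultra_scale (a : K) (z : ultrapower) : ultrapower :=
  ultra_class (a *: repr (z : Quotient.quot null_seq)).

Lemma ultra_classZ a x : ultra_class (a *: x) = ultra_scale a (ultra_class x).
Proof.
apply/ultra_class_eq; rewrite -scalerBr rpredZ//; apply/ultra_class_eq.
by rewrite /ultra_class reprK.
Qed.

Let scaleA a c z :
  ultra_scale a (ultra_scale c z) = ultra_scale (a * c) z.
Proof.
by have [x <-] := ultra_class_surj z; rewrite -!ultra_classZ scalerA.
Qed.

Let scale1 : left_id 1 ultra_scale.
Proof.
by move=> z; have [x <-] := ultra_class_surj z; rewrite -ultra_classZ scale1r.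
Qed.

Let scaleDr : right_distributive ultra_scale +%R.
Proof.
move=> a z w; have [x <-] := ultra_class_surj z.
have [y <-] := ultra_class_surj w.
by rewrite -ultra_classD -!ultra_classZ scalerDr ultra_classD.
Qed.

Let scaleDl z : {morph ultra_scale^~ z : a c / a + c}.
Proof.
move=> a c; have [x <-] := ultra_class_surj z.
by rewrite -!ultra_classZ scalerDl ultra_classD.
Qed.

HB.instance Definition _ := GRing.Zmodule_isLmodule.Build K ultrapower
  scaleA scale1 scaleDr scaleDl.

End NullSequences.

Section UltrapowerNorm.
Variables (R : realType) (b : base_field).
Local Notation K := (scalars R b).
Variables (X : normedModType K) (U : free_ultrafilter).
Local Notation XU := (ultrapower X U).

Definition ultra_norms (z : XU) : set K :=
  [set `|x| | x in [set x : linf X | ultra_class U x = z]].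

(* The quotient norm. *)
Definition ultra_norm (z : XU) : K := infimum 0 (ultra_norms z).

Lemma ultra_norm_inf z : infimums (ultra_norms z) (ultra_norm z).
Proof.
have [x xz] := ultra_class_surj z.
have nz : ultra_norms z !=set0 by exists `|x|, x.
rewrite /ultra_norm /infimum ifF; last exact/negP/negP/set0P.
have [|s sz] := scalars_infimums nz; first by move=> _ [y _ <-].
exact: (xgetI _ sz).
Qed.

Lemma ultra_norm_le x : ultra_norm (ultra_class U x) <= `|x|.
Proof. by have [+ _] := ultra_norm_inf (ultra_class U x); apply; exists x. Qed.

Lemma ultra_norm_ge z M :
  (forall x, ultra_class U x = z -> M <= `|x|) -> M <= ultra_norm z.
Proof.
by move=> zM; have [_] := ultra_norm_inf z; apply => _ [x /zM + <-].
Qed.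

Lemma ultra_norm_ge0 z : 0 <= ultra_norm z.
Proof. exact: ultra_norm_ge. Qed.

Lemma ultra_normD z w : ultra_norm (z + w) <= ultra_norm z + ultra_norm w.
Proof.
rewrite -lerBlDr; apply: ultra_norm_ge => x xz.
rewrite lerBlDr -lerBlDl; apply: ultra_norm_ge => y yw.
by rewrite lerBlDl (le_trans _ (ler_normD _ _))// -xz -yw -ultra_classD ultra_norm_le.
Qed.

Lemma ultra_normZ (a : K) z : ultra_norm (a *: z) = `|a| * ultra_norm z.
Proof.
have le c w : ultra_norm (c *: w) <= `|c| * ultra_norm w.
  have [->|c0] := eqVneq c 0.
    by rewrite scale0r normr0 mul0r -ultra_class0 (le_trans (ultra_norm_le _))// normr0.
  rewrite -ler_pdivrMl ?normr_gt0//; apply: ultra_norm_ge => x <-.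
  rewrite ler_pdivrMl ?normr_gt0// -normrZ.
  by rewrite (_ : _ *: _ = ultra_class U (c *: x)) ?ultra_norm_le// ultra_classZ.
apply/eqP; rewrite eq_le le /=.
have [->|a0] := eqVneq a 0; first by rewrite normr0 mul0r ultra_norm_ge0.
rewrite -ler_pdivlMl ?normr_gt0// -normfV.
by rewrite -[in leLHS](scalerK a0 z) le.
Qed.

Lemma ultra_norm0_eq0 z : ultra_norm z = 0 -> z = 0.
Proof.
have [x <-] := ultra_class_surj z => x0.
rewrite -(ultra_class0 X U).
apply/ultra_class_eq; rewrite subr0; apply/asboolP/cvgrPdist_lt => e e0.
have e20 : 0 < e / 2 by rewrite divr_gt0.
have [y yx ye] : exists2 y, ultra_class U y = ultra_class U x & `|y| < e / 2.
  apply: contrapT => noy.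
  suff : e / 2 <= ultra_norm (ultra_class U x) by rewrite x0 lt_geF.
  apply: ultra_norm_ge => y yx; rewrite (real_leNgt (gtr0_real e20) (ger0_real (normr_ge0 y))).
  by apply/negP => ye; apply: noy; exists y.
have /asboolP/cvgrPdist_lt/(_ _ e20) yx0 := (ultra_class_eq _ _ _).1 yx.
apply: filterS yx0 => n; rewrite !sub0r !normrN => yxn.
rewrite (_ : x n = y n - (y n - x n)); last by rewrite subKr.
rewrite (le_lt_trans (ler_normB _ _))// (splitr e) ltrD//.
exact: le_lt_trans (linf_norm_ub y n) ye.
Qed.

HB.instance Definition _ :=
  @Lmodule_isNormed.Build K XU ultra_norm ultra_normD ultra_normZ ultra_norm0_eq0.

Definition ultrapower_set (A : set X) : set XU :=
  [set ultra_class U x | x in [set x : linf X | forall n, A (x n)]].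

End UltrapowerNorm.
Arguments ultrapower_set {R b X} U A.

Definition rel_super_weakly_compact (R : realType) (b : base_field)
    (X : normedModType (scalars R b)) (A : set X) : Prop :=
  forall U : free_ultrafilter, rel_weakly_compact (ultrapower_set U A).

(* Main.v *)
(* Suppose (x_n) is weakly Cauchy but not weakly convergent. Convex combinations
   of finitely many terms cannot be arbitrarily close to convex combinations of
   all tails (otherwise they would approximate the weak* limit of (x_n) in X**,
   which would lie in X by completeness), so a subsequence (z_n) satisfies
   dist(conv {z_j : j <= i}, conv {z_j : j > i}) >= e for all i.
   The differences z_{k+j} - z_k with j <= k form a weakly null family, hence a
   relatively weakly compact set A. In the ultrapower, y_j := [z_{k+j} - z_k]_k
   lies in A^U, and translating by z_k shows that
   dist(conv {y_j : j <= i}, conv {y_j : j > i}) >= e for all i.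
   By Mazur's theorem (y_j) then has no weak cluster point.
   Complex spaces are treated through real-linear functionals. *)
From HB Require Import structures.
Require Import Defs.
From mathcomp Require Import all_boot all_order all_algebra.
From mathcomp Require Import complex.
From mathcomp Require Import all_classical all_reals all_analysis.
From mathcomp Require Import ring lra zify.
Set Implicit Arguments.
Unset Strict Implicit.
Unset Printing Implicit Defensive.
Import Order.TTheory GRing.Theory Num.Theory.
Import numFieldNormedType.Exports.
Local Open Scope classical_set_scope.
Local Open Scope ring_scope.

(** * Hahn-Banach separation *)

Section HahnBanach.
Variables (R : realType) (V : lmodType R).
Implicit Types (p q : V -> R) (C : set V).

Definition sublinear p :=
  (forall v w, p (v + w) <= p v + p w) /\
  (forall t v, 0 <= t -> p (t *: v) <= t * p v).

Definition convex C := forall c d (t : R),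
  C c -> C d -> 0 <= t <= 1 -> C (t *: c + (1 - t) *: d).

(** The cone spanned by a convex set is closed under addition: normalising the weights by [s + t]
    gives a convex combination. When [s + t = 0] both weights vanish and any point of [C] serves. *)
Lemma convex_cone C c d (s t : R) : convex C -> C c -> C d -> 0 <= s -> 0 <= t ->
  exists2 e, C e & s *: c + t *: d = (s + t) *: e.
Proof.
move=> cC Cc Cd s0 t0; have [st0|st0] := eqVneq (s + t) 0.
  exists c => //; have -> : s = 0 by lra.
  have -> : t = 0 by lra.
  by rewrite !scale0r add0r addr0 scale0r.
have st : 0 < s + t by rewrite lt0r st0 addr_ge0.
exists ((s / (s + t)) *: c + (1 - s / (s + t)) *: d).
  by apply: cC => //; rewrite divr_ge0 ?(ltW st)//= ler_pdivrMr// mul1r lerDl.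
rewrite scalerDr !scalerA mulrBr mulr1 mulrCA divff// mulr1.
by rewrite [s + t]addrC addrK.
Qed.

Lemma sublinear0 p : sublinear p -> p 0 = 0.
Proof.
case=> pD pZ; apply/eqP; rewrite eq_le; apply/andP; split.
  by have := pZ 0 0 (lexx _); rewrite scale0r mul0r.
by have := pD 0 0; rewrite addr0; lra.
Qed.

Lemma sublinearZ p t v : sublinear p -> 0 <= t -> p (t *: v) = t * p v.
Proof.
move=> sp; rewrite le0r => /predU1P[->|t0].
  by rewrite scale0r mul0r sublinear0.
case: sp => pD pZ; apply/eqP; rewrite eq_le pZ ?(ltW t0)//=.
rewrite -ler_pdivlMl// -[in leLHS](scalerK (lt0r_neq0 t0) v).
by apply: pZ; rewrite invr_ge0 ltW.
Qed.

Lemma sublinearN p v : sublinear p -> - p (- v) <= p v.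
Proof.
by move=> sp; have := sp.1 v (- v); rewrite subrr sublinear0//; lra.
Qed.

(* The relaxed functional is p v = inf {q (v + t c) - t e | t >= 0, c in C}. *)
Lemma sublinear_relax q C (e : R) : sublinear q -> convex C -> C !=set0 ->
    (forall c, C c -> e <= q c) ->
  exists p, [/\ sublinear p, forall v, p v <= q v &
    forall c, C c -> p (- c) <= - e].
Proof.
move=> sq cC [c0 Cc0] qe; have [qD _] := sq.
pose E v := [set q (v + tc.1 *: tc.2) - tc.1 * e |
  tc in [set tc : R * V | 0 <= tc.1 /\ C tc.2]].
(* The infimum is finite: subadditivity at [v + t *: c] and [- v], together with [t * e <= t * q c],
   bounds [E v] from below. *)
have lbE v : lbound (E v) (- q (- v)).
  move=> _ [[t c] /= [t0 Cc] <-].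
  have := qD (v + t *: c) (- v); rewrite addrAC subrr add0r sublinearZ//.
  by have : t * e <= t * q c by [rewrite ler_wpM2l// qe]; lra.
have E0 v : E v !=set0 by eexists; exists (0, c0).
have lE v t c : 0 <= t -> C c -> inf (E v) <= q (v + t *: c) - t * e.
  by move=> t0 Cc; apply: ge_inf; [exists (- q (- v))|exists (t, c)].
exists (fun v => inf (E v)); split.
- split=> [v w|t v].
    rewrite -lerBlDr; apply: lb_le_inf => // _ [[s c] /= [s0 Cc] <-].
    rewrite lerBlDr -lerBlDl; apply: lb_le_inf => // _ [[t d] /= [t0 Cd] <-].
    rewrite lerBlDl; have [f Cf stf] := convex_cone cC Cc Cd s0 t0.
    apply: le_trans (lE _ (s + t) f _ _) _ => //; first exact: addr_ge0.
    by rewrite -stf addrACA; have := qD (v + s *: c) (w + t *: d); lra.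
  rewrite le0r => /predU1P[->|t0].
    rewrite scale0r mul0r; apply: le_trans (lE 0 0 c0 _ _) _ => //.
    by rewrite scale0r addr0 sublinear0// mul0r subrr.
  rewrite -ler_pdivrMl//; apply: lb_le_inf => // _ [[s c] /= [s0 Cc] <-].
  rewrite ler_pdivrMl//; apply: le_trans (lE _ (t * s) c _ _) _ => //.
    by rewrite mulr_ge0// ltW.
  by rewrite -scalerA -scalerDr sublinearZ// ?(ltW t0)// mulrBr mulrA.
- move=> v; apply: le_trans (lE v 0 c0 _ _) _ => //.
  by rewrite scale0r addr0 mul0r subr0.
- move=> c Cc; apply: le_trans (lE (- c) 1 c _ _) _ => //.
  by rewrite scale1r addNr sublinear0// mul1r add0r.
Qed.

(** Zorn's lemma. A nonempty chain is bounded by its pointwise infimum, which stays subadditive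
    because of two members of a chain the smaller can replace the other. *)
Lemma minimal_sublinear p : sublinear p -> exists q,
  [/\ sublinear q, forall v, q v <= p v &
    forall r, sublinear r -> (forall v, r v <= q v) -> r = q].
Proof.
move=> sp; pose T := {q | sublinear q /\ forall v, q v <= p v}.
(* The order is reversed, so that a maximal element is a minimal functional. *)
pose le (q r : T) := `[< forall v, sval r v <= sval q v >].
have [||q r /asboolP qr /asboolP rq|A totA|[q [sq qp]] qmin] := @Zorn T le.
- by move=> q; apply/asboolP.
- move=> q r s /asboolP qr /asboolP rs; apply/asboolP => v.
  exact: le_trans (rs v) (qr v).
- case: q r qr rq => [q Hq] [r Hr] /= qr rq; apply: eq_exist.
  by apply/funext => v; apply/eqP; rewrite eq_le qr rq.
- have [[a Aa]|/nonemptyPn A0] := pselect (A !=set0); last first.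
    by exists (exist _ p (conj sp (fun=> lexx _))) => s; rewrite A0.
  pose E v := [set sval q v | q in A].
  have lbE v : lbound (E v) (- p (- v)).
    move=> _ [[q [sq qp]] /= Aq <-]; apply: le_trans (sublinearN v sq).
    by rewrite lerN2.
  have E0 v : E v !=set0 by exists (sval a v), a.
  have lE v (q : T) : A q -> inf (E v) <= sval q v.
    by move=> Aq; apply: ge_inf; [exists (- p (- v))|exists q].
  have sE : sublinear (fun v => inf (E v)).
    split=> [v w|t v].
      rewrite -lerBlDr; apply: lb_le_inf => // _ [q Aq <-].
      rewrite lerBlDr -lerBlDl; apply: lb_le_inf => // _ [r Ar <-].
      rewrite lerBlDl; have [/asboolP qr|/asboolP rq] := totA _ _ Aq Ar.
        apply: le_trans (lE _ _ Ar) _; have [rD _] := (svalP r).1.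
        by apply: le_trans (rD _ _) _; rewrite lerD2r.
      apply: le_trans (lE _ _ Aq) _; have [qD _] := (svalP q).1.
      by apply: le_trans (qD _ _) _; rewrite lerD2l.
    rewrite le0r => /predU1P[->|t0].
      rewrite scale0r mul0r; apply: le_trans (lE _ _ Aa) _.
      by rewrite sublinear0//; exact: (svalP a).1.
    rewrite -ler_pdivrMl//; apply: lb_le_inf => // _ [q Aq <-].
    rewrite ler_pdivrMl//; apply: le_trans (lE _ _ Aq) _.
    by rewrite (sublinearZ _ (svalP q).1) ?(ltW t0).
  have Ep v : inf (E v) <= p v.
    by apply: le_trans (lE _ _ Aa) _; exact: (svalP a).2.
  exists (exist _ (fun v => inf (E v)) (conj sE Ep)) => q Aq.
  by apply/asboolP => v; exact: lE.
exists q; split=> // r sr rq.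
have rp v : r v <= p v by exact: le_trans (rq v) (qp v).
by have /(_ _)/(congr1 sval) := qmin (exist _ r (conj sr rp));
  apply; apply/asboolP.
Qed.

(* Relaxing a minimal q at the single point w with level q w changes nothing,
   which forces q (- w) = - q w. *)
Lemma minimal_sublinear_scalar q : sublinear q ->
  (forall r, sublinear r -> (forall v, r v <= q v) -> r = q) ->
  scalar q.
Proof.
move=> sq qmin.
have qN w : q (- w) = - q w.
  have [|||r [sr rq rw]] := @sublinear_relax q [set w] (q w) sq.
  - by move=> c d t -> -> _; rewrite -scalerDl addrC subrK scale1r.
  - by exists w.
  - by move=> c ->.
  apply/eqP; rewrite eq_le -[in leLHS](qmin r)// rw//=.
  by have := sublinearN w sq; lra.
have qD v w : q (v + w) = q v + q w.
  apply/eqP; rewrite eq_le sq.1/=; have := sq.1 (v + w) (- w).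
  by rewrite addrK qN; lra.
move=> t v w; rewrite qD; congr (_ + _).
have [t0|/ltW t0] := leP 0 t; first by rewrite sublinearZ.
by rewrite -[t *: v]opprK -scaleNr qN sublinearZ ?oppr_ge0// mulNr opprK.
Qed.

(** Relaxation encodes the bound on [C] as [p (- c) <= - e]. A minimal sublinear functional below
    [p] is linear, so that [f c = - f (- c) >= e]. *)
Theorem separation (N : V -> R) C (e : R) : sublinear N -> convex C ->
    C !=set0 -> (forall c, C c -> e <= N c) ->
  exists f : V -> R, [/\ scalar f, forall v, f v <= N v &
    forall c, C c -> e <= f c].
Proof.
move=> sN cC C0 Ne; have [p [sp pN pe]] := sublinear_relax sN cC C0 Ne.
have [f [sf fp fmin]] := minimal_sublinear sp.
have lf := minimal_sublinear_scalar sf fmin.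
exists f; split=> // [v|c Cc]; first exact: le_trans (fp v) (pN v).
have := sublinearN c sf; have := fp (- c); have := pe _ Cc.
have := lf 1 c (- c); rewrite scale1r subrr sublinear0// mul1r; lra.
Qed.

End HahnBanach.

(** * Real-linear functionals *)

Section Scalars.
Variable R : realType.

(** Real part and real embedding, by cases on the field, so that later arguments treat both fields
    at once. *)
Definition reb b : scalars R b -> R :=
  match b with RealScalars => id | ComplexScalars => @complex.Re R end.

Definition inb b : R -> scalars R b :=
  match b with RealScalars => id | ComplexScalars => real_complex R end.

Variable b : base_field.
Implicit Types (z w : scalars R b) (x y : R).

Lemma reb0 : reb (0 : scalars R b) = 0. Proof. by case: b. Qed.
Lemma rebD z w : reb (z + w) = reb z + reb w.
Proof. by case: b z w => //= -[? ?] [? ?]. Qed.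
Lemma rebN z : reb (- z) = - reb z.
Proof. by case: b z => //= -[? ?]. Qed.
Lemma rebB z w : reb (z - w) = reb z - reb w.
Proof. by rewrite rebD rebN. Qed.
Lemma inbK x : reb (inb b x) = x. Proof. by case: b. Qed.
Lemma rebZ x z : reb (inb b x * z) = x * reb z.
Proof. by case: b z => //= -[? ?] /=; rewrite mul0r subr0. Qed.
Lemma inb0 : inb b 0 = 0. Proof. by case: b. Qed.
Lemma inb1 : inb b 1 = 1. Proof. by case: b. Qed.
Lemma inbD x y : inb b (x + y) = inb b x + inb b y.
Proof. by case: b => //=; rewrite rmorphD. Qed.
Lemma inbM x y : inb b (x * y) = inb b x * inb b y.
Proof. by case: b => //=; rewrite rmorphM. Qed.
Lemma ler_inb x y : (inb b x <= inb b y) = (x <= y).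
Proof. by case: b => //=; rewrite lecR. Qed.
Lemma ltr_inb x y : (inb b x < inb b y) = (x < y).
Proof. by case: b => //=; rewrite ltcR. Qed.
Lemma inb_norm x : `|inb b x| = inb b `|x|.
Proof.
case: b => //=; apply: etrans (normc_def _) _.
by rewrite /= expr0n /= addr0 sqrtr_sqr.
Qed.
Lemma ger0_inb z : 0 <= z -> inb b (reb z) = z.
Proof. by case: b z => //= -[x y]; rewrite lecE /= => /andP[/eqP-> _]. Qed.
Lemma real_inb z : z \is Num.real -> inb b (reb z) = z.
Proof.
case: b z => //= -[x y]; rewrite complex_real /= => /eqP->//.
Qed.
Lemma ler_reb z w : z <= w -> reb z <= reb w.
Proof. by case: b z w => //= -[? ?] [? ?]; rewrite lecE /= => /andP[]. Qed.
Lemma ltr_reb z w : z < w -> reb z < reb w.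
Proof. by case: b z w => //= -[? ?] [? ?]; rewrite ltcE /= => /andP[]. Qed.
Lemma norm_reb z : `|reb z| <= reb `|z|.
Proof.
case: b z => //= -[x y] /=.
by rewrite -sqrtr_sqr ler_wsqrtr// lerDl sqr_ge0.
Qed.

End Scalars.
Arguments inb {R} b.

(** An alias of [V], so that a second, real scalar multiplication can live on the same vectors. *)
Definition realified (R : realType) (b : base_field)
  (V : lmodType (scalars R b)) : Type := V.

Section Realified.
Variables (R : realType) (b : base_field) (V : lmodType (scalars R b)).

HB.instance Definition _ := GRing.Zmodule.on (realified V).

Let rscale (t : R) (v : realified V) : realified V := inb b t *: (v : V).

Let rscaleA t s v : rscale t (rscale s v) = rscale (t * s) v.
Proof. by rewrite /rscale scalerA inbM. Qed.
Let rscale1 : left_id 1 rscale.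
Proof. by move=> v; rewrite /rscale inb1 scale1r. Qed.
Let rscaleDr : right_distributive rscale +%R.
Proof. by move=> t v w; rewrite /rscale scalerDr. Qed.
Let rscaleDl v : {morph rscale^~ v : t s / t + s}.
Proof. by move=> t s; rewrite /rscale inbD scalerDl. Qed.

HB.instance Definition _ := GRing.Zmodule_isLmodule.Build R (realified V)
  rscaleA rscale1 rscaleDr rscaleDl.

Lemma realifiedZ (t : R) (v : V) : t *: (v : realified V) = inb b t *: v.
Proof. by []. Qed.

End Realified.

Section RealNorm.
Variables (R : realType) (b : base_field) (V : normedModType (scalars R b)).

Definition rnorm (v : realified V) : R := reb `|v : V|.

Lemma rnormE (v : V) : `|v| = inb b (rnorm v).
Proof. by rewrite /rnorm ger0_inb. Qed.

Lemma rnorm_ge0 v : 0 <= rnorm v.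
Proof. by rewrite -(ler_inb b) inb0 -rnormE. Qed.

Lemma rnormD v w : rnorm (v + w) <= rnorm v + rnorm w.
Proof. by rewrite /rnorm -rebD ler_reb// ler_normD. Qed.

Lemma rnormN v : rnorm (- v) = rnorm v.
Proof. by rewrite /rnorm normrN. Qed.

Lemma rnormZ t v : rnorm (t *: v) = `|t| * rnorm v.
Proof. by rewrite /rnorm realifiedZ normrZ inb_norm rebZ. Qed.

Lemma rnorm_sublinear : sublinear rnorm.
Proof. by split=> [|t v t0]; [exact: rnormD|rewrite rnormZ ger0_norm]. Qed.

(** Boundedness is stated one-sidedly; applying it at [- v] yields the bound on [|g v|]. *)
Definition real_functional (M : R) (g : realified V -> R) :=
  scalar g /\ forall v, g v <= M * rnorm v.

Section Functional.
Variables (M : R) (g : realified V -> R).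
Hypothesis gM : real_functional M g.

Lemma real_functionalD v w : g (v + w) = g v + g w.
Proof. by have := gM.1 1 v w; rewrite scale1r mul1r. Qed.
Lemma real_functional0 : g 0 = 0.
Proof. by have := real_functionalD 0 0; rewrite addr0; lra. Qed.
Lemma real_functionalZ t v : g (t *: v) = t * g v.
Proof. by have := gM.1 t v 0; rewrite !addr0 real_functional0 addr0. Qed.
Lemma real_functionalN v : g (- v) = - g v.
Proof. by rewrite -scaleN1r real_functionalZ mulN1r. Qed.
Lemma real_functionalB v w : g (v - w) = g v - g w.
Proof. by rewrite real_functionalD real_functionalN. Qed.
Lemma real_functional_le v : `|g v| <= M * rnorm v.
Proof.
by rewrite ler_norml gM.2 lerNl -real_functionalN -(rnormN v) gM.2.
Qed.

End Functional.

Lemma rnorm_separation (C : set (realified V)) (e : R) : convex C -> C !=set0 ->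
    (forall c, C c -> e <= rnorm c) ->
  exists2 g, real_functional 1 g & forall c, C c -> e <= g c.
Proof.
move=> cC C0 Ce; have [g [lg gN ge]] := separation rnorm_sublinear cC C0 Ce.
by exists g => //; split=> // v; rewrite mul1r.
Qed.

(** Hahn-Banach separation applied to the singleton of [v], at level [rnorm v]. *)
Lemma norming_functional v : exists2 g, real_functional 1 g & g v = rnorm v.
Proof.
have [|||g gM gv] := @rnorm_separation [set v] (rnorm v).
- by move=> c d t -> -> _; rewrite -scalerDl addrC subrK scale1r.
- by exists v.
- by move=> c ->.
exists g => //; apply/eqP; rewrite eq_le gv// andbT.
by have := gM.2 v; rewrite mul1r.
Qed.

Lemma topdual_real (f : topdual V) :
  exists M, real_functional M (fun v => reb (f v)).
Proof.
case: f => f cf /=.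
have /linear_bounded_continuous/linear_boundedP fb := cf.
have [M [Mr fM]] := fb.
(* Boundedness holds for every constant strictly above the real scalar [M], hence the shift by 1. *)
have [N MN] : exists N, M < inb b N.
  by exists (reb M + 1); rewrite inbD real_inb// inb1 ltrDl.
exists N; split=> [t v w|v].
  by rewrite realifiedZ linearP rebD rebZ.
have /ler_reb := fM _ MN v; rewrite rnormE -inbM inbK; apply: le_trans.
exact: le_trans (ler_norm _) (norm_reb _).
Qed.

End RealNorm.

Lemma normci (R : realType) : `|'i%C : scalars R ComplexScalars| = 1.
Proof.
by apply: etrans (normc_def _) _; rewrite /= expr0n expr1n add0r sqrtr1.
Qed.

Lemma normc_le (R : rcfType) (x y : R) :
  `|(x +i* y)%C| <= (`|x| + `|y|)%:C%C.
Proof.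
rewrite normc_def /= lecR -(ger0_norm (addr_ge0 (normr_ge0 x) (normr_ge0 y))).
rewrite -sqrtr_sqr ler_wsqrtr// sqrrD !real_normK ?num_real//.
by rewrite addrAC lerDl mulrn_wge0// mulr_ge0.
Qed.

(** Over the reals [g] itself serves; over the complex numbers, [f v = g v - i g (i v)] is
    complex-linear with real part [g]. *)
Lemma topdual_of_real (R : realType) (b : base_field)
    (V : normedModType (scalars R b)) (M : R) (g : realified V -> R) :
  real_functional M g -> exists f : topdual V, forall v, reb (f v) = g v.
Proof.
case: b V g => V g gM.
  have lg : scalar (g : V -> R) by move=> t v w; exact: gM.1.
  pose h : {linear V -> R^o} :=
    HB.pack (g : V -> R^o) (GRing.isLinear.Build _ _ _ _ _ lg).
  have ch : continuous h.
    apply/linear_bounded_continuous/bounded_funP => r.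
    exists (`|M| * r) => v vr; apply: le_trans (real_functional_le gM v) _.
    apply: le_trans (_ : `|M| * rnorm v <= _).
      by rewrite ler_wpM2r ?rnorm_ge0// ler_norm.
    by rewrite ler_wpM2l.
  by exists (TopDual ch).
pose f (v : V) : R[i] := (g v +i* (- g ('i *: v)))%C.
have gZ x (u : V) : g (x%:C%C *: u) = x * g u := real_functionalZ gM x u.
have gD (u v : V) : g (u + v) = g u + g v := real_functionalD gM u v.
have gN (u : V) : g (- u) = - g u := real_functionalN gM u.
have lf : scalar f.
  move=> [x y] v w.
  have aE u : (x +i* y)%C *: u = x%:C%C *: u + y%:C%C *: ('i%C *: u) :> V.
    rewrite scalerA -scalerDl; congr (_ *: _).
    by apply/eqP; rewrite eq_complex /=; apply/andP; split; apply/eqP; ring.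
  have iiE u : 'i%C *: ('i%C *: u) = - u :> V.
    rewrite scalerA -[RHS]scaleN1r; congr (_ *: _).
    by apply/eqP; rewrite eq_complex /=; apply/andP; split; apply/eqP; ring.
  rewrite /f scalerDr scalerA mulrC -scalerA !aE iiE.
  rewrite !gD !gZ gN.
  by apply/eqP; rewrite eq_complex /=; apply/andP; split; apply/eqP; ring.
pose h : {linear V -> R[i]^o} :=
  HB.pack (f : V -> R[i]^o) (GRing.isLinear.Build _ _ _ _ _ lf).
have ch : continuous h.
  apply/linear_bounded_continuous/bounded_funP => r.
  exists ((`|M| * reb r) *+ 2)%:C%C => v vr.
  have rv : rnorm v <= reb r by rewrite /rnorm ler_reb.
  have riv : rnorm ('i%C *: v : V) <= reb r.
    by rewrite /rnorm normrZ normci mul1r.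
  have gle u : rnorm u <= reb r -> `|g u| <= `|M| * reb r.
    move=> ur; apply: le_trans (real_functional_le gM u) _.
    apply: le_trans (_ : `|M| * rnorm u <= _).
      by rewrite ler_wpM2r ?rnorm_ge0// ler_norm.
    by rewrite ler_wpM2l.
  apply: le_trans (normc_le _ _) _.
  by rewrite lecR mulr2n normrN lerD// gle.
by exists (TopDual ch).
Qed.

(** * The weak topology *)

Lemma initial_cvg (S : choiceType) (W : topologicalType) (f : S -> W) (T : Type)
    (F : set_system T) {FF : Filter F} (x : T -> initial_topology f)
    (l : initial_topology f) :
  f (x t) @[t --> F] --> f l -> x @ F --> l.
Proof.
move=> xl A; rewrite nbhsE => -[B [[C oC <-] Cl] BA].
have /xl : nbhs (f l) C by apply: open_nbhs_nbhs.
rewrite nbhs_simpl /= nbhs_simpl /= => FC.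
by apply: (@filterS _ _ _ _ _ _ FC) => t; exact: BA.
Qed.

Lemma weak_cvgP (K : numFieldType) (V : normedModType K) (T : Type)
    (F : set_system T) {FF : Filter F} (x : T -> V) (l : V) :
  (x : T -> weak V) @ F --> (l : weak V) <->
  forall f : topdual V, f (x t) @[t --> F] --> f l.
Proof.
pose ev : weak V -> {ptws topdual V -> K^o} := fun v f => f v.
split=> [xl f|xl].
  have evl : ev (x t) @[t --> F] --> ev l.
    by apply: continuous_cvg xl; exact: initial_continuous.
  have := cvg_comp _ _ evl (@proj_continuous _ (fun=> K^o) f (ev l)).
  exact.
(* The pointwise topology is a supremum of initial topologies of the coordinates, so [initial_cvg]
   is used a second time for each coordinate. *)
apply: initial_cvg; apply/cvg_sup => f.
exact: (@initial_cvg _ _ (fun g : topdual V -> K^o => g f) _ _ _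
  (fun t => ev (x t)) (ev l) (xl f)).
Qed.

Section RealWeak.
Variables (R : realType).

Lemma real_functional_cvg b (V : normedModType (scalars R b)) (T : Type)
    (F : set_system T) {FF : Filter F} (x : T -> V) (l : V) M g :
  (x : T -> weak V) @ F --> (l : weak V) -> real_functional M g ->
  g (x t) @[t --> F] --> g l.
Proof.
move=> /weak_cvgP xl gM; have [f fg] := topdual_of_real gM.
apply/cvgrPdist_lt => e e0.
have /cvgrPdist_lt/(_ (inb b e)) := xl f; rewrite -inb0 ltr_inb => /(_ e0).
apply: filterS => t /ltr_reb; rewrite inbK; apply: le_lt_trans.
by rewrite -!fg -rebB norm_reb.
Qed.

Lemma weak_cvg_real b (V : normedModType (scalars R b)) (T : Type)
    (F : set_system T) {FF : Filter F} (x : T -> V) (l : V) :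
  (forall M g, real_functional M g -> g (x t) @[t --> F] --> g l) ->
  (x : T -> weak V) @ F --> (l : weak V).
Proof.
case: b V x l => V x l xl; apply/weak_cvgP => f; have [M fM] := topdual_real f.
  exact: xl fM.
(* The real part of [f (i v)] is minus the imaginary part of [f v], so this functional controls the
   imaginary part. *)
have fiM : real_functional M (fun v => reb (f ('i%C *: (v : V)))).
  split=> [t v w|v].
    by rewrite realifiedZ scalerDr scalerA mulrC -scalerA linearP rebD rebZ.
  have := fM.2 ('i%C *: v : V).
  suff -> : rnorm ('i%C *: v : V) = rnorm v by [].
  by rewrite /rnorm normrZ normci mul1r.
apply/cvgrPdist_lt => -[e e'] /= /[dup] + e0.
rewrite ltcE /= => /andP[/eqP e'0 ep]; subst e'.
have e2 : 0 < e / 2 by rewrite divr_gt0.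
have /cvgrPdist_lt/(_ _ e2) := xl _ _ fM.
have /cvgrPdist_lt/(_ _ e2) := xl _ _ fiM.
apply: filterS2 => t; rewrite !linearZ /=; move: (f l) (f (x t)) => [a b] [c d] /=.
move=> bd ac; apply: le_lt_trans (normc_le (a - c) (b - d)) _.
rewrite ltcR (splitr e) ltrD//.
by rewrite !mul0r !mul1r !sub0r opprK addrC in bd; rewrite distrC.
Qed.

Variables (b : base_field) (V : normedModType (scalars R b)).

Lemma real_functional_nbhs M g (l : V) (e : R) : real_functional M g -> 0 < e ->
  nbhs (l : weak V) [set v | `|g l - g v| < e].
Proof.
move=> gM e0.
have /cvgrPdist_lt : g v @[v --> (l : weak V)] --> g l.
  by apply: (@real_functional_cvg b V (weak V) (nbhs (l : weak V)) _ id l M g _ gM).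
exact.
Qed.

Lemma weak_hausdorff : hausdorff_space (weak V).
Proof.
move=> p q pq; have [g gM gpq] := norming_functional (p - q : V).
apply: contrapT => /eqP; rewrite -subr_eq0 -normr_gt0 => npq.
have r0 : 0 < rnorm (p - q : V) / 2.
  by rewrite divr_gt0// -(ltr_inb b) inb0 -rnormE.
have [v [/= gpv gqv]] := pq _ _ (real_functional_nbhs (p : V) gM r0)
  (real_functional_nbhs (q : V) gM r0).
have : rnorm (p - q : V) <= `|g p - g v| + `|g q - g v|.
  rewrite -gpq (real_functionalB gM) (distrC (g q)).
  by apply: le_trans (ler_norm _) (ler_distD _ _ _).
by apply/negP; rewrite -ltNge (splitr (rnorm _)) ltrD.
Qed.

(** Mazur's theorem: otherwise the convex set [C - y] avoids the open ball of radius [e], and a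
    functional that is at least [e] on it defines a weak neighbourhood of [y] missing [C]. *)
Lemma weak_closure_convex (C : set (realified V)) (y : V) : convex C ->
    closure (C : set (weak V)) y ->
  forall e, 0 < e -> exists2 c, C c & rnorm (c - (y : realified V)) < e.
Proof.
move=> cC Cy e e0; apply: contrapT => /forall2NP Ce.
have [c0 [Cc0 _]] := Cy _ filterT.
have [|||g gM ge] := @rnorm_separation _ _ _ [set c - (y : realified V) | c in C] e.
- move=> _ _ t [c Cc <-] [d Cd <-] t01.
  exists (t *: c + (1 - t) *: d); first exact: cC.
  rewrite !scalerBr addrACA -opprD -scalerDl.
  by rewrite [t + _]addrC subrK scale1r.
- by exists (c0 - (y : realified V)), c0.
- by move=> _ [c Cc <-]; have [//|/negP] := Ce c; rewrite -leNgt.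
have [c [Cc /= gc]] := Cy _ (real_functional_nbhs y gM e0).
have : e <= g (c - (y : realified V)) by apply: ge; exists c.
apply/negP; rewrite -ltNge (real_functionalB gM).
by apply: le_lt_trans (ler_norm _) _; rewrite distrC.
Qed.

(** A proper filter on [A] with 0 adjoined either clusters at 0 or contains some [A] minus [W],
    which is finite and hence compact. *)
Lemma weakly_null_compact (A : set V) :
    (forall W, nbhs (0 : weak V) W -> finite_set (A `\` W)) ->
  rel_weakly_compact A.
Proof.
move=> Afin; exists (A `|` [set 0] : set (weak V)); first by move=> a; left.
suff cA : compact (A `|` [set 0] : set (weak V)).
  by split=> //; exact: compact_closed weak_hausdorff cA.
move=> F FF FA; have [F0|] := pselect (cluster F (0 : weak V)).
  by exists 0; split=> //; right.
move=> /existsNP[S] /existsNP[W] /not_implyP[FS] /not_implyP[W0 SW].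
have FD : F (A `\` W).
  apply: filterS (filterI FS FA) => v [Sv Av].
  have Wv : ~ W v by move=> Wv; apply: SW; exists v.
  by case: Av => [//|v0]; case: Wv; rewrite v0; exact: (nbhs_singleton W0).
have [v [[Av _] Fv]] := @finite_compact (weak V) _ (Afin _ W0) F FF FD.
by exists v; split; [left|].
Qed.

End RealWeak.

(** * Uniform boundedness *)

(** Freeness yields a member of [U] omitting [N]; intersecting with it raises the bound by one. *)
Lemma free_ultrafilter_ge (U : free_ultrafilter) N :
  (\forall n \near fu_sets U, (N <= n)%N).
Proof.
elim: N => [|N IH]; first exact: filterE.
have : ~ (\bigcap_(A in fu_sets U) A) N by rewrite fu_free.
move=> /existsNP[A] /not_implyP[UA AN].
apply: filterS2 IH UA => n; rewrite leq_eqVlt => /predU1P[<-//|//].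
Qed.

Lemma free_ultrafilter_inhabited : inhabited free_ultrafilter.
Proof.
have [G [GU ooG]] := @ultraFilterLemma _ (nbhs \oo) _.
have G0 : \bigcap_(A in G) A = set0.
  rewrite -subset0 => n Gn; have : (n < n)%N.
    by apply: (Gn [set m | (n < m)%N]); apply: ooG; exists n.+1.
  by rewrite ltnn.
by exists; exact: (FreeUltrafilter GU G0).
Qed.

Section UltraLimit.
Variables (R : realType) (U : free_ultrafilter).

(** Compactness of the segment gives a cluster point, and a cluster point of an ultrafilter is a
    limit. *)
Lemma bounded_ultra_cvg (u : nat -> R) (M : R) : (forall n, `|u n| <= M) ->
  exists l : R, u n @[n --> fu_sets U] --> l.
Proof.
move=> uM; have [|l [_ ul]] := @segment_compact R (- M) M (fmap u (fu_sets U)).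
  apply: (@filterE _ (fu_sets U)) => n /=.
  by rewrite in_itv /= -ler_norml.
exists l => A lA; have [//|UA] := in_ultra_setVsetC (u @^-1` A) (fu_ultra U).
by have [r [nAr Ar]] := ul (~` A) A UA lA.
Qed.

Lemma ultra_lim_le (u : nat -> R) (l a M : R) :
  u n @[n --> fu_sets U] --> l ->
  (\forall n \near fu_sets U, `|u n - a| <= M) -> `|l - a| <= M.
Proof.
move=> ul; apply: cvgr_to_le.
by apply: cvg_norm; apply: cvgB => //; exact: cvg_cst.
Qed.

End UltraLimit.

Section UniformBoundedness.
Variables (R : realType) (b : base_field) (V : normedModType (scalars R b)).

(* Gliding hump: with w_k = z_{n_k} of norm greater than 2k 3^(k+1) and h_k norming
   w_k, add +/- 3^-(k+1) h_k at step k, the sign being chosen so that the k-th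
   partial sum is at least 3^-(k+1) |w_k| in absolute value at w_k; all later
   terms together change this value by at most half as much. *)
Lemma weakly_bounded_bounded (z : nat -> V) :
    (forall M g, real_functional M g -> exists B, forall n, `|g (z n)| <= B) ->
  exists B, forall n, rnorm (z n) <= B.
Proof.
move=> zB; apply: contrapT => /forallNP zunb.
have [w wz wk] : exists2 w : nat -> V, forall k, exists n, w k = z n &
    forall k, (3 ^+ k.+1 *+ 2) * k%:R < rnorm (w k).
  have /choice[n nk] k : exists n, (3 ^+ k.+1 *+ 2) * k%:R < rnorm (z n).
    by have /existsNP[n /negP] := zunb ((3 ^+ k.+1 *+ 2) * k%:R);
      rewrite -ltNge; exists n.
  by exists (z \o n) => // k; exists (n k).
have /choice[h hP] k : exists h : realified V -> R,
    real_functional 1 h /\ h (w k) = rnorm (w k).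
  by have [h] := norming_functional (w k); exists h.
pose s k : R := 3 ^- k.+1.
have s0 k : 0 < s k by rewrite invr_gt0 exprn_gt0.
have sS k : s k = 3 * s k.+1.
  by rewrite /s (exprS _ k.+1) invfM mulrA divff ?mul1r// pnatr_eq0.
pose Phi := fix Phi k : realified V -> R := if k is k'.+1 then
    if s k' * rnorm (w k') <= `|Phi k' (w k') + s k' * h k' (w k')|
    then fun v => Phi k' v + s k' * h k' v else fun v => Phi k' v - s k' * h k' v
  else fun=> 0.
have Phi_scalar k : scalar (Phi k).
  elim: k => [|k IH] t v x /=; first by rewrite mulr0 addr0.
  by case: ifP => _; rewrite IH (hP k).1.1; ring.
have PhiS k v : `|Phi k.+1 v - Phi k v| <= s k * rnorm v.
  have := real_functional_le (hP k).1 v; rewrite mul1r => hv /=.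
  by case: ifP => _; rewrite addrAC subrr add0r ?normrN normrM gtr0_norm// ler_pM2l.
(* If the plus sign fails, then [Phi k (w k)] is negative, so subtracting the hump adds up absolute
   values. *)
have Phi_w k : s k * rnorm (w k) <= `|Phi k.+1 (w k)|.
  rewrite /=; case: ifPn => //; rewrite -ltNge (hP k).2 ltr_norml => /andP[_ Phi0].
  by rewrite distrC; apply: le_trans (ler_norm _); move: Phi0; lra.
(* The factor [3 / 2 * (s k - s m)] is the exact sum of [s j] for [k <= j < m]; the exact form
   carries the induction. *)
have PhiD k m v : (k <= m)%N -> `|Phi m v - Phi k v| <= 3 / 2 * (s k - s m) * rnorm v.
  elim: m => [|m IH]; first by rewrite leqn0 => /eqP->; rewrite !subrr normr0 mulr0 mul0r.
  rewrite leq_eqVlt => /predU1P[->|]; first by rewrite !subrr normr0 mulr0 mul0r.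
  rewrite ltnS => /IH IHm; have := PhiS m v.
  have := ler_distD (Phi m v) (Phi m.+1 v) (Phi k v).
  by move: IHm; rewrite (sS m); lra.
have {}PhiD k m v : (k <= m)%N -> `|Phi m v - Phi k v| <= 3 / 2 * s k * rnorm v.
  move=> /PhiD -/(_ v)/le_trans; apply; rewrite ler_wpM2r ?rnorm_ge0// ler_wpM2l//.
  by have := s0 m; lra.
have [U] := free_ultrafilter_inhabited.
have /choice[phi Pphi] v : exists l : R, Phi n v @[n --> fu_sets U] --> l.
  apply: (@bounded_ultra_cvg _ _ _ (3 / 2 * s 0%N * rnorm v)) => n.
  by have := @PhiD 0%N n v isT; rewrite subr0.
have phiD k v : `|phi v - Phi k v| <= 3 / 2 * s k * rnorm v.
  apply: ultra_lim_le (Pphi v) _.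
  by apply: filterS (free_ultrafilter_ge U k) => m; exact: PhiD.
have phi_real : real_functional (3 / 2 * s 0%N) phi.
  split=> [t v x|v]; last first.
    by have := phiD 0%N v; rewrite subr0; apply: le_trans; exact: ler_norm.
  apply: cvg_unique (Pphi _) _ => //.
  have -> : Phi^~ (t *: v + x) = fun n => t * Phi n v + Phi n x.
    by apply/funext => n; exact: Phi_scalar.
  by apply: cvgD => //; apply: cvgM => //; exact: cvg_cst.
have [B phiB] := zB _ _ phi_real.
have [k Bk] : exists k : nat, B < k%:R.
  by exists (Num.truncn B).+1; exact: truncnS_gt.
have [n wn] := wz k; have := phiB n; rewrite -wn => phiw.
have kw : k%:R * 2 < s k * rnorm (w k).
  have := wk k; rewrite -(ltr_pM2l (s0 k)); apply: le_lt_trans.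
  by rewrite -(mulr_natr (3 ^+ _)) !mulrA mulVf ?mul1r 1?mulrC// expf_neq0.
have := phiD k.+1 (w k); have := Phi_w k.
have := ler_distD (phi (w k)) (Phi k.+1 (w k)) 0; rewrite !subr0 distrC.
(* The tail after step [k] costs half of the hump, so [|phi (w k)|] exceeds [k], hence [B]. *)
have -> : 3 / 2 * s k.+1 * rnorm (w k) = s k * rnorm (w k) / 2 by rewrite (sS k); field.
by move: kw phiw; lra.
Qed.

End UniformBoundedness.

(** * Separated convex hulls *)

Section Hull.
Variables (R : realType) (V : lmodType R).
Implicit Types (S C : set V).

(** As an intersection of convex sets, the hull has an induction principle: a property holds on it
    once it is convex and holds on [S]. *)
Definition hull S : set V := [set v | forall C, convex C -> S `<=` C -> C v].

Lemma hull_convex S : convex (hull S).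
Proof.
move=> c d t Sc Sd t01 C cC SC.
by apply: (cC _ _ _ _ _ t01); [exact: Sc|exact: Sd].
Qed.

Lemma sub_hull S : S `<=` hull S.
Proof. by move=> v Sv C _; exact. Qed.

Lemma hull_sub S C : convex C -> S `<=` C -> hull S `<=` C.
Proof. by move=> cC SC v; exact. Qed.

Lemma hullS S S' : S `<=` S' -> hull S `<=` hull S'.
Proof. by move=> SS'; apply: hull_sub (@hull_convex _) _ => v /SS'; exact: sub_hull. Qed.

(** Of the convex coefficients only boundedness is kept, which suffices for taking their limits
    along an ultrafilter. *)
Lemma hull_coef (x : nat -> V) i v : hull [set x j | j in [set j | (j < i)%N]] v ->
  exists2 t : nat -> R, (forall j, `|t j| <= 1) & v = \sum_(j < i) t j *: x j.
Proof.
move: v; apply: hull_sub.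
  move=> _ _ a [t t1 ->] [s s1 ->] /andP[a0 a1].
  exists (fun j => a * t j + (1 - a) * s j) => [j|].
    apply: le_trans (ler_normD _ _) _.
    rewrite !normrM (ger0_norm a0) (ger0_norm (_ : 0 <= 1 - a)) ?subr_ge0//.
    by have := t1 j; have := s1 j; nra.
  rewrite !scaler_sumr -big_split/=; apply: eq_bigr => j _.
  by rewrite !scalerA -scalerDl.
move=> _ [j ji <-]; exists (fun k => (k == j)%:R) => [k|].
  by case: eqP; rewrite ?normr1 ?normr0.
rewrite (bigD1 (Ordinal ji))//= eqxx scale1r big1 ?addr0// => k.
by rewrite -val_eqE /= => /negPf->; rewrite scale0r.
Qed.

End Hull.

(** * Approximating the weak* limit in the bidual from inside the space *)

Section WeakLimit.
Variables (R : realType) (b : base_field).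

Section Normed.
Variable V : normedModType (scalars R b).
Implicit Types (x : nat -> V) (g : realified V -> R).

Lemma weakly_cauchy_real x M g : weakly_cauchy x -> real_functional M g ->
  exists L : R, g (x n) @[n --> \oo] --> L.
Proof.
move=> xC gM; have [f fg] := topdual_of_real gM.
have /cvg_ex[/= l xl] := xC f.
exists (reb (l : scalars R b)); apply/cvgrPdist_lt => e e0.
have /cvgrPdist_lt/(_ (inb b e)) := xl; rewrite -inb0 ltr_inb => /(_ e0).
apply: filterS => t /ltr_reb; rewrite inbK; apply: le_lt_trans.
by rewrite -fg -rebB norm_reb.
Qed.

Lemma real_functional_sum M g n (t : nat -> R) (x : nat -> realified V) :
  real_functional M g ->
  g (\sum_(j < n) t j *: x j) = \sum_(j < n) t j * g (x j).
Proof.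
move=> gM; elim: n => [|n IH]; first by rewrite !big_ord0 (real_functional0 gM).
by rewrite !big_ord_recr /= (real_functionalD gM) IH (real_functionalZ gM).
Qed.

(* The combinations c_m of the terms below i have coefficients in [-1, 1]; a limit
   of the c_m along an ultrafilter plays the role of a compactness argument. *)
Lemma hull_tail_approx (x : nat -> realified V) i (e : R) :
    (forall m, exists c u : realified V,
      [/\ hull [set x j | j in [set j | (j < i)%N]] c,
        hull [set x j | j in [set j | (m <= j)%N]] u &
        rnorm (c - u) < e]) ->
  exists c : realified V, forall M g (L : R), 0 <= M -> real_functional M g ->
    g (x n) @[n --> \oo] --> L -> `|g c - L| <= M * e.
Proof.
move=> /choice[c /choice[u cu]].
have /choice[t tP] m : exists t : nat -> R, (forall j, `|t j| <= 1) /\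
    c m = \sum_(j < i) t j *: x j.
  by have [/hull_coef[t t1 ->] _ _] := cu m; exists t.
have [U] := free_ultrafilter_inhabited.
have /choice[tau tauP] j : exists l : R, t n j @[n --> fu_sets U] --> l.
  by apply: (@bounded_ultra_cvg _ _ _ 1) => n; exact: (tP n).1.
exists (\sum_(j < i) tau j *: x j) => M g L M0 gM xL.
have cU : g (c m) @[m --> fu_sets U] -->
    g (\sum_(j < i) tau j *: x j).
  rewrite (real_functional_sum _ _ _ gM).
  have -> : (fun m => g (c m)) = fun m => \sum_(j < i) t m j * g (x j).
    by apply/funext => m /=; rewrite (tP m).2 (real_functional_sum _ _ _ gM).
  by apply: cvg_big => [|j _]; [exact: add_continuous|apply: cvgM => //; exact: cvg_cst].
apply/ler_addgt0Pr => d d0; apply: ultra_lim_le cU _.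
have /cvgrPdist_le/(_ _ d0)[N _ xN] := xL.
apply: filterS (free_ultrafilter_ge U N) => m Nm.
have [_ um cum] := cu m.
(* The vectors with [|g v - L| <= d] form a convex set containing the tail from [m], hence its
   hull. *)
have uL : `|g (u m) - L| <= d.
  move: (um) => /(_ [set v | `|g v - L| <= d]); apply.
    move=> v w s /= vd wd /andP[s0 s1].
    rewrite (real_functionalD gM) !(real_functionalZ gM).
    have -> : s * g v + (1 - s) * g w - L = s * (g v - L) + (1 - s) * (g w - L) by ring.
    apply: le_trans (ler_normD _ _) _.
    rewrite !normrM (ger0_norm s0) (ger0_norm (_ : 0 <= 1 - s)) ?subr_ge0//.
    by move: vd wd; nra.
  by move=> _ [j /= mj <-]; rewrite distrC; apply: xN; exact: leq_trans Nm mj.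
apply: le_trans (ler_distD (g (u m)) _ _) _; apply: lerD => //.
rewrite -(real_functionalB gM); apply: le_trans (real_functional_le gM _) _.
by rewrite ler_wpM2l// ltW.
Qed.

End Normed.

Variable X : completeNormedModType (scalars R b).

(** The hypothesis says that points of [X] approximate the weak* limit in norm. Such approximants
    form a Cauchy sequence, and its norm limit is the weak limit. *)
Lemma weakly_cauchy_approx_cvg (x : nat -> X) : weakly_cauchy x ->
    (forall e : R, 0 < e -> exists c : realified X, forall M g (L : R), 0 <= M ->
      real_functional M g -> g (x n) @[n --> \oo] --> L -> `|g c - L| <= M * e) ->
  exists l, weakly_cvg_to x l.
Proof.
move=> xC xapp; pose e k : R := k.+1%:R^-1.
have e0 k : 0 < e k by rewrite invr_gt0.
have /choice[c cP] k := xapp _ (e0 k).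
have cc k l : rnorm (c k - c l) <= e k + e l.
  (* A norming functional turns the two estimates on functional values into a norm estimate. *)
  have [g gM <-] := norming_functional (c k - c l).
  have [L gL] := weakly_cauchy_real xC gM.
  have := cP k _ _ _ ler01 gM gL; have := cP l _ _ _ ler01 gM gL.
  rewrite !mul1r (real_functionalB gM) !ler_norml; lra.
have : cvg ((c : nat -> X) @ \oo).
  apply/cauchy_cvgP/cauchy_ballP => d d0.
  have rd : 0 < reb d / 2 by rewrite divr_gt0// -(reb0 R b) ltr_reb.
  have eN : \forall k \near \oo, e k < reb d / 2.
    exact: near_infty_natSinv_lt (PosNum rd).
  have [N _ Ne] := eN; pose T := c @` [set k | (N <= k)%N].
  exists (T, T); first by split; exists N => // k Nk; exists k.
  move=> [_ _] [/= [k Nk <-] [l Nl <-]]; rewrite -ball_normE /=.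
  rewrite rnormE -(@ger0_inb _ b d) ?ltW// ltr_inb.
  apply: le_lt_trans (cc k l) _; rewrite (splitr (reb d)) ltrD//; exact: Ne.
move=> /cvg_ex[/= l cl]; exists l; apply: weak_cvg_real => M g gM.
have [L gL] := weakly_cauchy_real xC gM.
suff -> : g l = L by [].
have gM' : real_functional `|M| g.
  split=> [|v]; first exact: gM.1.
  by apply: le_trans (gM.2 v) _; rewrite ler_wpM2r ?rnorm_ge0// ler_norm.
apply/eqP; rewrite -subr_eq0 -normr_le0; apply/ler_addgt0Pr => d d0; rewrite add0r.
(* Chosen so that two errors of size [|M| * r] add up to at most [d]; the added 1 covers [M = 0]. *)
pose r := d / 2 / (`|M| + 1).
have r0 : 0 < r by rewrite !divr_gt0// ltr_wpDl.
have [k [ek lk]] : exists k, e k < r /\ rnorm ((l : realified X) - c k) < r.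
  have ek : \forall k \near \oo, e k < r by exact: near_infty_natSinv_lt (PosNum r0).
  have /cvgrPdist_lt/(_ (inb b r)) := cl; rewrite -inb0 ltr_inb => /(_ r0) lk.
  have [k [ek' lk']] := filter_ex (filterI ek lk).
  by exists k; split=> //; rewrite rnormE ltr_inb in lk'.
apply: le_trans (ler_distD (g (c k)) _ _) _.
have rM : `|M| * r + `|M| * r <= d.
  rewrite /r; have -> : `|M| * (d / 2 / (`|M| + 1)) + `|M| * (d / 2 / (`|M| + 1)) =
      d * `|M| / (`|M| + 1).
    by field; rewrite gt_eqF// ltr_wpDl.
  by rewrite ler_pdivrMr ?ltr_wpDl// ler_pM2l// lerDl.
apply: le_trans rM; apply: lerD.
  rewrite -(real_functionalB gM); apply: le_trans (real_functional_le gM' _) _.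
  by rewrite ler_wpM2l// ltW.
by apply: le_trans (cP k _ _ _ (normr_ge0 M) gM' gL) _; rewrite ler_wpM2l// ltW.
Qed.

End WeakLimit.

(** * The separated subsequence and its weakly null differences *)

Section Main.
Variables (R : realType) (b : base_field).

Lemma separated_subsequence (X : completeNormedModType (scalars R b))
    (x : nat -> X) :
    weakly_cauchy x -> ~ (exists l, weakly_cvg_to x l) ->
  exists (z : nat -> realified X) (e : R), [/\ weakly_cauchy (z : nat -> X), 0 < e &
    forall i c u, hull [set z j | j in [set j | (j <= i)%N]] c ->
      hull [set z j | j in [set j | (i < j)%N]] u -> e <= rnorm (c - u)].
Proof.
move=> xC xnl.
have [e e0 xe] : exists2 e : R, 0 < e &
    ~ exists c : realified X, forall M g (L : R), 0 <= M ->
      real_functional M g -> g (x n) @[n --> \oo] --> L -> `|g c - L| <= M * e.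
  apply: contrapT => /forall2NP xapp; apply: xnl.
  apply: weakly_cauchy_approx_cvg => // e e0.
  by have [//|/contrapT] := xapp e.
pose xr : nat -> realified X := x.
have /choice[m mP] i : exists m, forall c u,
    hull [set xr j | j in [set j | (j < i)%N]] c ->
    hull [set xr j | j in [set j | (m <= j)%N]] u -> e <= rnorm (c - u).
  apply: contrapT => /forallNP im; apply: xe; apply: (@hull_tail_approx _ _ _ xr i) => k.
  have /existsNP[c /existsNP[u /not_implyP[cx /not_implyP[ux /negP cu]]]] := im k.
  by exists c, u; split=> //; rewrite ltNge.
(* The terms of [xr] up to index [n k] are the first [(n k).+1] ones; the next index is past the
   tail threshold that [m] assigns to them. *)
pose n := fix n k := if k is k'.+1 then maxn (n k').+1 (m (n k').+1) else 0%N.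
have nS k : (n k < n k.+1)%N by rewrite /= leq_maxl.
have n_homo k l : (k < l)%N -> (n k < n l)%N by move: k l; exact: (homo_ltn ltn_trans nS).
have n_ge k : (k <= n k)%N by elim: k => // k IH; exact: leq_ltn_trans (nS k).
exists (xr \o n), e; split=> // [f|i c u ci ui].
  have /cvg_ex[l xl] := xC f; apply/cvg_ex; exists l.
  apply: (cvg_comp n (fun k => f (x k)) _ xl).
  by move=> A [N _ NA]; exists N => // k /= Nk; apply: NA; exact: leq_trans (n_ge k).
apply: (mP (n i).+1).
  apply: hullS ci => _ [j /= ji <-]; exists (n j) => //=.
  move: ji; rewrite ltnS leq_eqVlt => /predU1P[->//|/n_homo]; exact: ltnW.
apply: hullS ui => _ [j /= ij <-]; exists (n j) => //=.
apply: (@leq_trans (n i.+1)); first by rewrite /= leq_maxr.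
move: ij; rewrite leq_eqVlt => /predU1P[<-//|/n_homo]; exact: ltnW.
Qed.

Lemma weakly_cauchy_dist (V : normedModType (scalars R b)) (z : nat -> V) W :
  weakly_cauchy z -> nbhs (0 : weak V) W ->
  exists N, forall k l, (N <= k)%N -> (N <= l)%N -> W (z k - z l).
Proof.
move=> zC W0.
have : (fun kl : nat * nat => z kl.1 - z kl.2 : weak V) @ (filter_prod \oo \oo)
    --> (0 : weak V).
  apply: weak_cvg_real => M g gM; have [L gL] := weakly_cauchy_real zC gM.
  rewrite (real_functional0 gM) -(subrr L).
  have -> : (fun kl : nat * nat => g (z kl.1 - z kl.2)) =
      fun kl => g (z kl.1) - g (z kl.2).
    by apply/funext => kl; rewrite -(real_functionalB gM).
  apply: cvgB.
    exact: cvg_comp cvg_fst gL.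
  exact: cvg_comp cvg_snd gL.
move=> /(_ _ W0) [[P Q] /= [[N1 _ NP] [N2 _ NQ]] PQW].
exists (maxn N1 N2) => k l; rewrite !geq_max => /andP[k1 k2] /andP[l1 l2].
by apply: (PQW (k, l)); split=> /=; [exact: NP|exact: NQ].
Qed.

(** A weak neighbourhood of 0 contains all differences with [k >= N]. The constraint [j <= k] leaves
    only finitely many pairs with [k < N]. *)
Lemma differences_weakly_compact (V : normedModType (scalars R b)) (z : nat -> V) :
  weakly_cauchy z ->
  rel_weakly_compact [set z (kj.1 + kj.2)%N - z kj.1 | kj in [set kj | (kj.2 <= kj.1)%N]].
Proof.
move=> zC; apply: weakly_null_compact => W W0.
have [N zN] := weakly_cauchy_dist zC W0.
have : finite_set [set z (kj.1 + kj.2)%N - z kj.1 | kj in `I_N `*` `I_N].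
  by apply: finite_image; exact: finite_setX.
apply: sub_finite_set => _ [[[k j] /= jk <-] Wkj]; exists (k, j) => //=.
have kN : (k < N)%N.
  by rewrite ltnNge; apply/negP => Nk; apply: Wkj; apply: zN => //; lia.
by split=> //; exact: leq_ltn_trans jk kN.
Qed.

(** * Ultrapowers *)

Section Ultrapower.
Variables (X : normedModType (scalars R b)) (U : free_ultrafilter).

(** Any other representative differs from [w] by a [U]-null sequence, so its supremum norm is at
    least [e - d] for each positive [d]. *)
Lemma ultra_rnorm_ge (w : linf X) (e : R) :
  (\forall k \near fu_sets U, e <= rnorm (w k)) ->
  e <= rnorm (ultra_class U w : ultrapower X U).
Proof.
move=> we; rewrite -(ler_inb b) -rnormE; apply: ultra_norm_ge => x.
move=> /ultra_class_eq/asboolP/cvgrPdist_lt xw.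
rewrite rnormE ler_inb; apply/ler_addgt0Pr => d d0.
have := xw (inb b d); rewrite -inb0 ltr_inb => /(_ d0) {}xw.
have [k [ek]] := filter_ex (filterI we xw).
rewrite sub0r normrN rnormE ltr_inb => xwk.
have xk : rnorm (x k) <= rnorm x by rewrite /rnorm ler_reb// linf_norm_ub.
have := rnormD (x k : realified X) (- (x k - w k)).
rewrite subKr (rnormN (x k - w k : realified X)) => wk.
apply: le_trans ek _; apply: le_trans wk _; apply: lerD => //.
exact: ltW.
Qed.

(* Representatives are compared after translation by z k, which turns the
   differences z (k + j) - z k back into terms of z. *)
Lemma hull_ultra_lift (Y : nat -> linf X) (z : nat -> realified X) (J : set nat)
    (S : nat -> set nat) (c : realified (ultrapower X U)) :
    (forall j, J j -> \forall k \near fu_sets U,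
      Y j k = z (k + j)%N - z k :> realified X) ->
    (forall j k, J j -> S k (k + j)%N) ->
    hull [set (ultra_class U (Y j) : realified (ultrapower X U)) | j in J] c ->
  exists2 w : linf X, ultra_class U w = c &
    \forall k \near fu_sets U, hull [set z l | l in S k] ((w k : realified X) + z k).
Proof.
move=> Yz JS; move: c; apply: hull_sub.
  move=> _ _ t [v <- vk] [w <- wk] t01.
  exists (inb b t *: v + inb b (1 - t) *: w).
    by rewrite ultra_classD !ultra_classZ.
  apply: filterS2 vk wk => k vk wk.
  have -> : ((inb b t *: v + inb b (1 - t) *: w) k : realified X) + z k =
      t *: ((v k : realified X) + z k) + (1 - t) *: ((w k : realified X) + z k).
    rewrite !scalerDr addrACA -scalerDl.
    by rewrite [t + _]addrC subrK scale1r.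
  exact: hull_convex.
move=> _ [j Jj <-]; exists (Y j) => //.
apply: filterS (Yz _ Jj) => k ->; apply: sub_hull; rewrite subrK.
by exists (k + j)%N => //; exact: JS.
Qed.

End Ultrapower.
End Main.

(** * Contradiction in the ultrapower *)

Lemma weakly_cauchy_bounded (R : realType) (b : base_field)
    (V : normedModType (scalars R b)) (z : nat -> V) :
  weakly_cauchy z -> exists B, forall n, rnorm (z n) <= B.
Proof.
move=> zC; apply: weakly_bounded_bounded => M g gM.
have [L gL] := weakly_cauchy_real zC gM.
have /cvg_seq_bounded : cvgn (fun n => g (z n)) by apply/cvg_ex; exists L.
have F : ProperFilter (globally [set: nat]).
  exact: (globally_properfilter (a := 0%N)).
by move=> /ex_bound[B gB]; exists B => n; exact: gB.
Qed.

Lemma hull_bigcup_nat (R : realType) (V : lmodType R) (Y : nat -> V) c :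
  hull (range Y) c -> exists i, hull [set Y j | j in [set j | (j <= i)%N]] c.
Proof.
move: c; apply: hull_sub.
  move=> c d t [i ic] [k kd] t01; exists (maxn i k).
  apply: hull_convex => //.
    by apply: hullS ic => _ [j /= ji <-]; exists j => //=; lia.
  by apply: hullS kd => _ [j /= ji <-]; exists j => //=; lia.
by move=> _ [j _ <-]; exists j; apply: sub_hull; exists j => /=.
Qed.

Theorem theorem2p8 (R : realType) (b : base_field)
    (X : completeNormedModType (scalars R b))
    (hX : forall A : set X, rel_weakly_compact A -> rel_super_weakly_compact A) :
  weakly_seq_complete X.
Proof.
move=> x xC; apply: contrapT => xnl.
have [z [e [zC e0 ze]]] := separated_subsequence xC xnl.
have [B zB] := weakly_cauchy_bounded zC.
have [U] := free_ultrafilter_inhabited.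
have [K AK [cK _]] := hX _ (differences_weakly_compact zC) U.
(* For [k < j] the default 0 is itself a difference, with second index 0, so [y j] stays in the
   compact family; these finitely many [k] are invisible to [U]. *)
pose y j k : X := if (j <= k)%N then z (k + j)%N - z k else 0.
have yb j : y j \in @bounded_seq _ X.
  apply/bounded_seqP; exists (inb b (B + B)) => k.
  rewrite rnormE ler_inb /y; case: ifP => _.
    by apply: le_trans (rnormD _ _) _; rewrite rnormN lerD.
  by rewrite /rnorm normr0 reb0 addr_ge0// (le_trans _ (zB 0%N))// rnorm_ge0.
pose Y j : linf X := Linf (yb j).
pose YU j : realified (ultrapower X U) := ultra_class U (Y j).
have YK j : K (YU j).
  apply: AK; exists (Y j) => // k; rewrite /= /y; case: ifP => jk; first by exists (k, j).
  by exists (k, 0%N) => //=; rewrite addn0 subrr.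
have [l [_ lcl]] : K `&` cluster (YU @ \oo : set_system (weak (ultrapower X U))) !=set0.
  by apply: cK; exists 0%N => // j _; exact: YK.
(* The cluster point lies in the weak closure of the hull of each tail, so by Mazur's theorem it is
   also a norm limit of such hulls. *)
have Yl (J : set nat) : nbhs \oo J ->
    exists2 c, hull [set YU j | j in J] c & rnorm (c - (l : realified _)) < e / 2.
  move=> ooJ; apply: weak_closure_convex; [exact: hull_convex| |by rewrite divr_gt0].
  move=> W Wl; apply: (lcl _ _ _ Wl).
  by apply: filterS ooJ => j Jj; apply: sub_hull; exists j.
have [c cY cl] := Yl setT filterT.
have [i {}cY] := hull_bigcup_nat cY.
have [|u uY ul] := Yl [set j | (i < j)%N]; first by exists i.+1.
have Yz j : \forall k \near fu_sets U, Y j k = z (k + j)%N - z k :> realified X.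
  by apply: filterS (free_ultrafilter_ge U j) => k jk; rewrite /= /y jk.
(* After translation by [z k], the representative of [c] uses indices up to [k + i], and below that
   of [u] uses later ones: the split separated by [ze]. *)
have [|v vc vz] :=
  hull_ultra_lift (S := fun k => [set j | (j <= k + i)%N]) (fun j _ => Yz j) _ cY.
  by move=> j k /=; rewrite leq_add2l.
have [|w wu wz] :=
  hull_ultra_lift (S := fun k => [set j | (k + i < j)%N]) (fun j _ => Yz j) _ uY.
  by move=> j k /=; rewrite ltn_add2l.
have vw : c - u = ultra_class U (v - w) :> ultrapower X U.
  by apply/eqP; rewrite subr_eq -wu -ultra_classD subrK vc.
have : e <= rnorm (c - u).
  rewrite vw; apply: ultra_rnorm_ge; apply: filterS2 vz wz => k vk wk.
  (* The translation by [z k] cancels in the difference. *)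
  suff -> : (v - w) k = (v k : realified X) + z k - ((w k : realified X) + z k).
    exact: ze vk wk.
  by rewrite opprD addrACA subrr addr0.
apply/negP; rewrite -ltNge (splitr e).
have -> : c - u = (c - (l : realified _)) - (u - (l : realified _)).
  by rewrite opprB addrA subrK.
by apply: le_lt_trans (rnormD _ _) _; rewrite rnormN ltrD.
Qed.
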